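(* Let $A\subset\mathbb{R}$ be a finite or countably infinite set with no accumulation points in $\mathbb{R}$, and let $F_A\subset P(\mathbb{R})$ be the set of Borel probability measures on $\mathbb{R}$ supported in $A$. If $A$ is linearly independent over $\mathbb{Q}$, then $F_A$ is good.
   Context: $P(\mathbb{R})$ denotes the set of Borel probability measures on $\mathbb{R}$, with the $\sigma$-algebra generated by the maps $\mu\mapsto\mu(B)$, $B\subset\mathbb{R}$ Borel; $P(P(\mathbb{R}))$ is the set of probability measures on $P(\mathbb{R})$. For $\Theta\in P(P(\mathbb{R}))$, a sequence $X=(X_j)_{j\in\mathbb{N}}$ of real random variables is iid-$\Theta$ if $\mathbb{P}(X\in B)=\int\theta^{\mathbb{N}}(B)\,d\Theta(\theta)$ for all Borel $B\subset\mathbb{R}^{\mathbb{N}}$, where $\theta^{\mathbb{N}}$ is the infinite product measure. A measurable set $L\subset P(\mathbb{R})$ is called good if the following holds: whenever $\Theta_1,\Theta_2\in P(P(\mathbb{R}))$ are concentrated on $L$, $X$ is iid-$\Theta_1$, $Y$ is iid-$\Theta_2$, and $\sum_{j=1}^n X_j$ and $\sum_{j=1}^n Y_j$ have the same distribution for every $n\ge 1$, then $\Theta_1=\Theta_2$. *)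

(* Defs.v *)
From mathcomp Require Export all_boot all_order all_algebra.
From mathcomp Require Export all_classical all_reals all_analysis.
From mathcomp Require Export measurable_realfun giry.

Set Implicit Arguments.
Unset Strict Implicit.
Unset Printing Implicit Defensive.

Import Order.TTheory GRing.Theory Num.Theory.
Export numFieldNormedType.Exports.

Local Open Scope classical_set_scope.
Local Open Scope ring_scope.

(* Measures here are functions on all of [set T], constrained only on
   measurable sets; equality of measures is therefore [measure_eq], i.e.
   agreement on measurable sets, and never Leibniz equality.  For the same
   reason a Borel probability measure on R has several representatives in
   [pprobability R R]; its sigma-algebra is generated by the evaluations at
   Borel sets, so it does not separate them. *)

(* R^N with the product sigma-algebra, which is also the Borel sigma-algebra of
   the product topology since R is second countable. *)
Definition real_sequences (R : realType) :=
  g_sigma_algebraType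
    (\bigcup_j preimage_set_system [set: nat -> R] (fun x => x j) measurable).

(* nu is the infinite product measure theta^N.  The cylinders below form a
   pi-system generating the sigma-algebra, so that nu is determined by theta on
   measurable sets. *)
Definition is_infinite_product (R : realType) (theta : probability R R)
    (nu : probability (real_sequences R) R) : Prop :=
  forall (n : nat) (B : nat -> set R), (forall j, measurable (B j)) ->
    nu [set x : nat -> R | forall j, (j < n)%N -> B j (x j)] =
    (\prod_(j < n) theta (B j))%E.

(* [prodm theta] is theta^N; it always exists, hence the existential quantifier
   merely names it. *)
Definition iid_mixture (R : realType)
    (Theta : probability (pprobability R R) R)
    (d : measure_display) (W : measurableType d) (P : probability W R)
    (X : nat -> {RV P >-> R}) : Prop :=
  exists prodm : pprobability R R -> probability (real_sequences R) R,
    (forall theta, is_infinite_product theta (prodm theta)) /\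
    forall B : set (real_sequences R), measurable B ->
      P [set w | B (fun j => X j w)] = (\int[ Theta ]_theta prodm theta B)%E.

Definition partial_sum (R : realType)
    (d : measure_display) (W : measurableType d) (P : probability W R)
    (X : nat -> {RV P >-> R}) (n : nat) : {RV P >-> R} :=
  \sum_(j < n) (X j : {mfun W >-> R}).

Definition good (R : realType) (L : set (pprobability R R)) : Prop :=
  measurable L /\
  forall (Theta1 Theta2 : probability (pprobability R R) R)
    (d1 : measure_display) (W1 : measurableType d1) (P1 : probability W1 R)
    (X : nat -> {RV P1 >-> R})
    (d2 : measure_display) (W2 : measurableType d2) (P2 : probability W2 R)
    (Y : nat -> {RV P2 >-> R}),
    Theta1 L = 1%E -> Theta2 L = 1%E ->
    iid_mixture Theta1 X -> iid_mixture Theta2 Y ->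
    (forall n : nat, (0 < n)%N ->
       measure_eq (distribution P1 (partial_sum X n))
                  (distribution P2 (partial_sum Y n))) ->
    measure_eq Theta1 Theta2.

(* This says that the topological support is included in A when A is closed, in
   particular when A has no accumulation point. *)
Definition supported_in (R : realType) (A : set R) : set (pprobability R R) :=
  [set mu : probability R R | mu A = 1%E].

Definition linearly_independent_over_Q (R : realType) (A : set R) : Prop :=
  forall (s : seq R) (q : R -> rat), uniq s -> (forall a, a \in s -> A a) ->
    \sum_(a <- s) ratr (q a) * a = 0 -> forall a, a \in s -> q a = 0.

(* Main.v *)
Require Import Defs.
From mathcomp Require Import ring lra.

(* Linear independence makes a sum a_1 + ... + a_n of elements of A determine
   the multiset {a_1, ..., a_n}.  Hence the law of X_1 + ... + X_n determines
   the mixed moments E[theta{a_1} ... theta{a_n}] of the random measure theta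
   with law Theta.  Since A carries theta, the bounded random variables
   theta(U), and then the indicators of [theta(U) < r], are obtained from the
   theta{a} by linear combinations, products and bounded pointwise limits;
   these operations preserve "having the same mean under Theta1 and Theta2,
   even after multiplication by a monomial in the theta{a}".  The sets
   [theta(U) < r] generate the sigma-algebra of P(R). *)

Set Implicit Arguments.
Unset Strict Implicit.
Unset Printing Implicit Defensive.

Import Order.TTheory GRing.Theory Num.Theory.

Local Open Scope classical_set_scope.
Local Open Scope ring_scope.

(** * Polynomials converging pointwise to a step function on [0, 1] *)

Lemma bernoulli_ineq (R : realDomainType) (x : R) (n : nat) :
  -1 <= x -> 1 + n%:R * x <= (1 + x) ^+ n.
Proof.
move=> x1; elim: n => [|n IHn]; first by rewrite mul0r addr0 expr0.
rewrite exprS; apply: (@le_trans _ _ ((1 + x) * (1 + n%:R * x))); last first.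
  by apply: ler_wpM2l => //; rewrite -lerBlDl sub0r.
rewrite -natr1 -subr_ge0.
have -> : (1 + x) * (1 + n%:R * x) - (1 + (n%:R + 1) * x) = n%:R * x ^+ 2.
  by ring.
by rewrite mulr_ge0// sqr_ge0.
Qed.

(** With [w] the square root of [z], the term is (n w^n) w^n, where the first factor stays bounded
    and the second tends to 0. *)
Lemma cvg_natM_expr (R : realType) (z : R) : 0 <= z < 1 ->
  (n%:R * z ^+ n) @[n --> \oo] --> (0 : R).
Proof.
move=> /andP[z0 z1]; pose w := Num.sqrt z.
have w0 : 0 <= w by rewrite sqrtr_ge0.
have w1 : w < 1 by rewrite -sqrtr1 ltr_sqrt.
have zw : z = w * w by rewrite -expr2 sqr_sqrtr.
(* By Bernoulli, w^n (1 + n (1 - w)) <= (w (2 - w))^n, and w (2 - w) = 1 - (1 - w)^2 <= 1. *)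
have nw n : n%:R * w ^+ n <= (1 - w)^-1.
  have w1' : 0 < 1 - w by rewrite subr_gt0.
  rewrite -[leRHS]mul1r ler_pdivlMr//.
  apply: (@le_trans _ _ (w ^+ n * (1 + (1 - w)) ^+ n)); last first.
    by rewrite -exprMn exprn_ile1//; nra.
  apply: (@le_trans _ _ (w ^+ n * (1 + n%:R * (1 - w)))).
    rewrite mulrAC [leLHS]mulrC ler_wpM2l ?exprn_ge0//.
    by rewrite lerDr.
  by rewrite ler_wpM2l ?exprn_ge0// bernoulli_ineq//; lra.
apply: (@squeeze_cvgr _ _ _ _ (cst 0) (fun n => (1 - w)^-1 * w ^+ n)).
- near=> n; rewrite mulr_ge0 ?exprn_ge0//=.
  by rewrite zw exprMn mulrA ler_wpM2r ?exprn_ge0.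
- exact: cvg_cst.
- rewrite -[X in _ --> X](mulr0 (1 - w)^-1); apply: cvgMl_tmp.
  by apply: cvg_expr; rewrite ger0_norm.
Unshelve. all: by end_near. Qed.

(* With y = (x + 1 - t) / 2 this is (1 - y^n)^(n 2^n), which by Bernoulli's
   inequality is at least 1 - n (2y)^n when y < 1/2, and at most 1 / (1 + n)
   when y >= 1/2.  The factor n in the exponent is what gives the limit 0 at
   the threshold y = 1/2 itself. *)
Definition step_poly (R : realType) (t : R) (n : nat) : {poly R} :=
  (1 - (2^-1 *: ('X + (1 - t)%:P)) ^+ n) ^+ (n * 2 ^ n).

Lemma horner_step_poly (R : realType) (t : R) (n : nat) (x : R) :
  (step_poly t n).[x] = (1 - ((x + 1 - t) / 2) ^+ n) ^+ (n * 2 ^ n).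
Proof.
rewrite /step_poly horner_exp hornerD hornerN horner_exp hornerZ hornerD.
by rewrite hornerX !hornerC addrA [2^-1 * _]mulrC.
Qed.

Lemma step_poly_ge0_le1 (R : realType) (t : R) (n : nat) (x : R) :
  0 <= t <= 1 -> 0 <= x <= 1 -> 0 <= (step_poly t n).[x] <= 1.
Proof.
move=> t01 x01; rewrite horner_step_poly.
have y0 : 0 <= (x + 1 - t) / 2 by lra.
have y1 : (x + 1 - t) / 2 <= 1 by lra.
have := exprn_ge0 n y0; have := exprn_ile1 n y0 y1 => u1 u0.
by rewrite exprn_ge0 ?exprn_ile1//; lra.
Qed.

Lemma cvg_step_poly (R : realType) (t x : R) :
  0 <= t <= 1 -> 0 <= x <= 1 ->
  (step_poly t n).[x] @[n --> \oo] --> ((x < t)%R%:R : R).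
Proof.
move=> t01 x01; pose y := (x + 1 - t) / 2.
have y0 : 0 <= y by rewrite /y; lra.
have y1 : y <= 1 by rewrite /y; lra.
have yn n : 0 <= y ^+ n <= 1 by rewrite exprn_ge0 ?exprn_ile1.
have pE n : (n * 2 ^ n)%:R * y ^+ n = n%:R * (y * 2) ^+ n :> R.
  by rewrite natrM natrX (exprMn _ y) mulrAC -mulrA.
have [xt|tx] := ltP x t.
- have z1 : 0 <= y * 2 < 1 by rewrite /y; lra.
  apply: (@squeeze_cvgr _ _ _ _ (fun n => 1 - n%:R * (y * 2) ^+ n) (cst 1)).
  + near=> n; have /andP[_ ->] := step_poly_ge0_le1 n t01 x01; rewrite andbT.
    rewrite horner_step_poly -/y -pE -mulrN bernoulli_ineq//.
    by have /andP[_] := yn n; rewrite lerN2.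
  + rewrite -[X in _ --> X]subr0; apply: cvgB; first exact: cvg_cst.
    exact: cvg_natM_expr.
  + exact: cvg_cst.
- apply: (@squeeze_cvgr _ _ _ _ (cst 0) (@harmonic R)).
  + near=> n; have /andP[-> _] := step_poly_ge0_le1 n t01 x01.
    rewrite horner_step_poly -/y /harmonic /=; set N := (n * 2 ^ n)%N.
    have /andP[u0 u1] := yn n; set u := y ^+ n in u0 u1 *.
    rewrite -[leRHS]mul1r ler_pdivlMr//.
    (* The product is (1 - u^2)^N <= 1, while Bernoulli gives (1 + u)^N >= 1 + N u = 1 + n (2y)^n >=
       1 + n, because 2y >= 1 here. *)
    apply: (@le_trans _ _ ((1 - u) ^+ N * (1 + u) ^+ N)); last first.
      by rewrite -exprMn exprn_ile1//; nra.
    rewrite ler_wpM2l ?exprn_ge0 ?subr_ge0//.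
    apply: le_trans (bernoulli_ineq _ _); last by lra.
    rewrite -natr1 addrC lerD2l pE ler_peMr// exprn_ege1//.
    by rewrite /y; lra.
  + exact: cvg_cst.
  + exact: cvg_harmonic.
Unshelve. all: by end_near. Qed.

(** * Functions with equal means under two measures, and their multipliers *)

Section multipliers.
Context d (T : measurableType d) (R : realType) (P1 P2 : probability T R).
Implicit Types f g h m : T -> R.

(** Boundedness keeps all means finite, so that this class is a vector space; it need not be closed
    under products. *)
Definition same_mean : set (T -> R) :=
  [set f : T -> R | [/\ measurable_fun [set: T] f, exists M, forall x, `|f x| <= M &
    (\int[P1]_x (f x)%:E = \int[P2]_x (f x)%:E)%E]].

Lemma bounded_measurable_integrable (P : probability T R) (f : T -> R) :
  measurable_fun [set: T] f -> (exists M, forall x, `|f x| <= M) ->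
  P.-integrable [set: T] (EFin \o f).
Proof.
move=> mf [M fM]; apply: measurable_bounded_integrable => //.
  by rewrite -ge0_fin_numE// fin_num_measure.
exists M; split; first exact: num_real.
by move=> K MK x _ /=; apply: le_trans (fM x) (ltW MK).
Qed.

Lemma same_meanD f g : same_mean f -> same_mean g -> same_mean (f \+ g).
Proof.
move=> [mf [M fM] fE] [mg [N gN] gE]; split.
- exact: measurable_funD.
- exists (M + N) => x; apply: le_trans (ler_normD _ _) _; exact: lerD.
- under eq_integral do rewrite EFinD.
  under [RHS]eq_integral do rewrite EFinD.
  rewrite !integralD//= ?fE ?gE//.
  all: by apply: bounded_measurable_integrable => //; first [by exists M|by exists N].
Qed.

Lemma same_meanZ c f : same_mean f -> same_mean (fun x => c * f x).
Proof.
move=> [mf [M fM] fE]; split.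
- exact: measurable_funM.
- by exists (`|c| * M) => x; rewrite normrM ler_wpM2l.
- under eq_integral do rewrite EFinM.
  under [RHS]eq_integral do rewrite EFinM.
  rewrite !integralZl//= ?fE//.
  all: by apply: bounded_measurable_integrable => //; exists M.
Qed.

Variables (L : set T) (mL : measurable L).
Hypotheses (P1L : P1 L = 1%E) (P2L : P2 L = 1%E).

Lemma full_ae (P : probability T R) (Q : T -> Prop) :
  P L = 1%E -> (forall x, L x -> Q x) -> {ae P, forall x, Q x}.
Proof.
move=> PL LQ; exists (~` L); split; first exact: measurableC.
  by rewrite probability_setC// PL subee.
by apply: subsetC => x Lx; exact: LQ.
Qed.

(** Dominated convergence under each measure. Convergence is required only on the full-measure set
    [L], so measurability and boundedness of [f] are not inherited from the [f_ n] and are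
    assumed. *)
Lemma same_mean_cvg (f_ : nat -> T -> R) (f : T -> R) (M : R) :
  (forall n, same_mean (f_ n)) -> (forall n x, `|f_ n x| <= M) ->
  measurable_fun [set: T] f -> (exists N, forall x, `|f x| <= N) ->
  (forall x, L x -> f_ n x @[n --> \oo] --> f x) -> same_mean f.
Proof.
move=> f_E f_M mf fN f_f; split => //.
have cvgI (P : probability T R) : P L = 1%E ->
    (\int[P]_x (f_ n x)%:E @[n --> \oo] --> \int[P]_x (f x)%:E)%E.
  move=> PL; have [] // := @dominated_convergence _ _ _ P setT measurableT
    (fun n x => (f_ n x)%:E) (fun x => (f x)%:E) (fun=> M%:E).
  - by move=> n; apply/measurable_EFinP; have [] := f_E n.
  - exact/measurable_EFinP.
  - apply: full_ae PL _ => x Lx _; apply/fine_cvgP; split; last exact: f_f.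
    exact: nearW.
  - apply: (@bounded_measurable_integrable P (cst M)) => //.
    by exists `|M| => x.
  - by apply: aeW => x n _; rewrite lee_fin.
rewrite -(cvg_lim _ (cvgI _ P1L))// -(cvg_lim _ (cvgI _ P2L))//.
by apply/congr_lim/funext => n; have [] := f_E n.
Qed.

Variable mon : set (T -> R).
Hypothesis mon1 : mon (cst 1).
Hypothesis monM : forall f g, mon f -> mon g -> mon (f \* g).
Hypothesis mon_same_mean : mon `<=` same_mean.

Definition same_moments : set (T -> R) :=
  [set f : T -> R | forall m, mon m -> same_mean (f \* m)].

(** Equality of means does not pass to products, but operators preserving [same_moments] can be
    composed: this form makes the multipliers an algebra, and it contains [mon]. *)
Definition multiplier : set (T -> R) :=
  [set g : T -> R | forall f, same_moments f -> same_moments (f \* g)].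

Lemma same_moments_mean f : same_moments f -> same_mean f.
Proof.
by move=> /(_ _ mon1); congr same_mean; apply/funext => x /=; rewrite mulr1.
Qed.

Lemma mon_multiplier g : mon g -> multiplier g.
Proof.
move=> mg f sf m mm; have := sf _ (monM mg mm).
by congr same_mean; apply/funext => x /=; rewrite mulrA.
Qed.

(** The constant 1 has the same moments, since monomials have the same mean; multiply it by [g]. *)
Lemma multiplier_mean g : multiplier g -> same_mean g.
Proof.
move=> /(_ (cst 1)) sg; apply: same_moments_mean.
rewrite (_ : g = cst 1 \* g); last by apply/funext => x /=; rewrite mul1r.
apply: sg => m mm; apply: mon_same_mean; rewrite (_ : _ \* _ = m)//.
by apply/funext => x /=; rewrite mul1r.
Qed.

Lemma multiplierD g h : multiplier g -> multiplier h -> multiplier (g \+ h).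
Proof.
move=> sg sh f sf m mm; have := same_meanD (sg _ sf _ mm) (sh _ sf _ mm).
by congr same_mean; apply/funext => x /=; rewrite mulrDr mulrDl.
Qed.

Lemma multiplierM g h : multiplier g -> multiplier h -> multiplier (g \* h).
Proof.
move=> sg sh f /sg /sh fgh m /fgh.
by congr same_mean; apply/funext => x /=; rewrite !mulrA.
Qed.

Lemma multiplier_cst c : multiplier (cst c).
Proof.
move=> f sf m /sf /(same_meanZ c); congr same_mean.
by apply/funext => x /=; rewrite mulrA (mulrC c).
Qed.

Lemma multiplier_horner (p : {poly R}) g :
  multiplier g -> multiplier (fun x => p.[g x]).
Proof.
move=> sg; elim/poly_ind: p => [|p c IHp].
  rewrite (_ : (fun _ => _) = cst 0); first exact: multiplier_cst.
  by apply/funext => x; rewrite horner0.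
rewrite (_ : (fun _ => _) = ((fun x => p.[g x]) \* g) \+ cst c).
  exact: multiplierD (multiplierM IHp sg) (multiplier_cst c).
by apply/funext => x; rewrite hornerMXaddC.
Qed.

Lemma multiplier_cvg (g_ : nat -> T -> R) (g : T -> R) (M : R) :
  (forall n, multiplier (g_ n)) -> (forall n x, `|g_ n x| <= M) ->
  measurable_fun [set: T] g -> (exists N, forall x, `|g x| <= N) ->
  (forall x, L x -> g_ n x @[n --> \oo] --> g x) -> multiplier g.
Proof.
move=> sg_ g_M mg [N gN] g_g f sf m mm.
have [mf [C fC] _] := same_moments_mean sf.
have [mem [D mD] _] := mon_same_mean mm.
apply: (@same_mean_cvg (fun n => f \* g_ n \* m) _ (C * M * D)).
- by move=> n; exact: sg_.
- move=> n x; rewrite /= !normrM.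
  by do 2?[apply: ler_pM => //]; rewrite mulr_ge0.
- by apply: measurable_funM => //; exact: measurable_funM.
- exists (C * N * D) => x; rewrite /= !normrM.
  by do 2?[apply: ler_pM => //]; rewrite mulr_ge0.
- move=> x Lx /=; apply: cvgMr_tmp; apply: cvgMl_tmp; exact: g_g.
Qed.

(** Polynomials in [g] are multipliers, and [step_poly t n] composed with [g] converges boundedly to
    the indicator, also where [g x = t]. *)
Lemma multiplier_lt g (t : R) : multiplier g -> (forall x, 0 <= g x <= 1) ->
  0 <= t <= 1 -> multiplier (fun x => (g x < t)%R%:R).
Proof.
move=> sg g01 t01; have [mg _ _] := multiplier_mean sg.
apply: (@multiplier_cvg (fun n x => (step_poly t n).[g x]) _ 1).
- by move=> n; exact: multiplier_horner.
- by move=> n x; have /andP[? ?] := step_poly_ge0_le1 n t01 (g01 x);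
    rewrite ger0_norm.
- rewrite (_ : (fun _ => _) = \1_(g @^-1` `]-oo, t[)).
    by apply: measurable_indic; rewrite -[X in measurable X]setTI; exact: mg.
  by apply/funext => x; rewrite indicE; congr (_ %:R); congr nat_of_bool;
    apply/idP/idP; rewrite in_setE/= in_itv.
- by exists 1 => x; case: (_ < _); rewrite ?normr1 ?normr0.
- by move=> x _; exact: cvg_step_poly.
Qed.

End multipliers.

(** * The evaluations theta(U) as random variables on P(R) *)

Section evaluation.
Context {R : realType}.

Definition evalp (U : set R) (theta : pprobability R R) : R :=
  fine ((theta : probability R R) U).

Lemma EFin_evalp U theta : measurable U ->
  (evalp U theta)%:E = (theta : probability R R) U.
Proof. by move=> mU; rewrite fineK// fin_num_measure. Qed.

Lemma evalp_ge0_le1 U theta : measurable U -> 0 <= evalp U theta <= 1.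
Proof.
move=> mU; rewrite -!lee_fin EFin_evalp// measure_ge0/=.
exact: probability_le1.
Qed.

Lemma measurable_evaluation (U : set R) : measurable U ->
  measurable_fun [set: pprobability R R]
    (fun theta => (theta : probability R R) U).
Proof.
move=> mU.
(* The identity of [pprobability R R] is read as a probability kernel. *)
exact: (measurable_kernel (kprobability (@measurable_id _ (pprobability R R) setT)) U mU).
Qed.

Lemma measurable_evalp (U : set R) : measurable U ->
  measurable_fun [set: pprobability R R] (evalp U).
Proof.
move=> mU; apply/measurable_EFinP.
rewrite (_ : _ \o _ = fun theta => (theta : probability R R) U).
  exact: measurable_evaluation.
by apply/funext => theta /=; rewrite EFin_evalp.
Qed.

Lemma measurable_supported_in (A : set R) : measurable A ->
  measurable (supported_in A).
Proof.
move=> mA; have := measurable_evaluation mA measurableT (emeasurable_set1 1%E).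
by rewrite setTI.
Qed.

Lemma supported_inI (A U : set R) (theta : pprobability R R) :
  measurable A -> measurable U -> supported_in A theta ->
  (theta : probability R R) (A `&` U) = (theta : probability R R) U.
Proof.
move=> mA mU thA; rewrite [RHS](measureDI _ mU mA) [X in _ = X + _](_ : _ = 0)%E.
  by rewrite add0e setIC.
apply/eqP; rewrite eq_le measure_ge0 andbT.
have <- : (theta : probability R R) (~` A) = 0%E.
  by rewrite probability_setC// thA subee.
apply: le_measure; rewrite ?inE; [exact: measurableD|exact: measurableC|].
by move=> x [].
Qed.

(** Repetitions in [s] give powers, the empty sequence gives 1, and concatenation gives products. *)
Definition atom_monomials (A : set R) : set (pprobability R R -> R) :=
  [set m | exists2 s : seq R, (forall a, a \in s -> A a) &
    m = fun theta => \prod_(a <- s) evalp [set a] theta].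

End evaluation.

(** * The mixed moments of the atoms determine the mixing measure *)

Section determined_by_moments.
Context {R : realType}.
Variables (A : set R) (Theta1 Theta2 : probability (pprobability R R) R).
Hypothesis cA : countable A.
Hypotheses (Theta1A : Theta1 (supported_in A) = 1%E)
           (Theta2A : Theta2 (supported_in A) = 1%E).
Hypothesis same : atom_monomials A `<=` same_mean Theta1 Theta2.

Let mA : measurable A.
Proof. by apply: countable_measurable => // t; exact: measurable_set1. Qed.

Let mon1 : atom_monomials A (cst 1).
Proof.
by exists [::] => //; apply/funext => theta; rewrite big_nil.
Qed.

Let monM f g : atom_monomials A f -> atom_monomials A g ->
  atom_monomials A (f \* g).
Proof.
move=> [s sA ->] [t tA ->]; exists (s ++ t).
  by move=> a; rewrite mem_cat => /orP[/sA|/tA].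
by apply/funext => theta; rewrite big_cat.
Qed.

Local Notation multiplier := (multiplier Theta1 Theta2 (atom_monomials A)).

Let multiplier_evalp1 a : A a -> multiplier (evalp [set a]).
Proof.
move=> Aa; apply: mon_multiplier => //; exists [:: a].
  by move=> b; rewrite inE => /eqP ->.
by apply/funext => theta; rewrite big_seq1.
Qed.

(** An injection of [A] into the naturals exhausts the part of [U] in [A] by sets [F n] that gain at
    most one point at each stage. So [evalp (F n)] is a finite sum of atoms, and it increases to
    [evalp U] at every theta carried by [A]. *)
Let multiplier_evalp (U : set R) : measurable U -> multiplier (evalp U).
Proof.
move=> mU; have /countable_injP[f finj] := cA.
pose F n := A `&` U `&` [set a | (f a < n)%N].
have mF n : measurable (F n).
  apply: countable_measurable; first by move=> t; exact: measurable_set1.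
  by apply: sub_countable cA; apply: subset_card_le => x [[]].
have mulF n : multiplier (evalp (F n)).
  elim: n => [|n IHn].
    rewrite (_ : evalp _ = cst 0); first exact: multiplier_cst.
    apply/funext => theta; rewrite /evalp (_ : F 0%N = set0) ?measure0//.
    by apply/seteqP; split => x // [].
  pose E := A `&` U `&` [set a | f a = n].
  have FE : F n.+1 = F n `|` E.
    apply/seteqP; split => x.
      move=> [AUx]; rewrite /= ltnS leq_eqVlt => /orP[/eqP|]; first by right.
      by left.
    by move=> [[AUx /= fx]|[AUx /= fx]]; split => //=; [exact: ltnW|rewrite fx].
  have mE : measurable E.
    apply: countable_measurable; first by move=> t; exact: measurable_set1.
    by apply: sub_countable cA; apply: subset_card_le => x [[]].
  rewrite (_ : evalp _ = evalp (F n) \+ evalp E); last first.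
    apply/funext => theta /=; rewrite /evalp FE measureU// ?fineD ?fin_num_measure//.
    apply/seteqP; split => x // [[_ /= fx] [_ /= fxn]].
    by rewrite fxn ltnn in fx.
  (* By injectivity of [f] on [A], the increment [E] is empty or a singleton. *)
  apply: multiplierD => //; have [E0|/set0P[a Ea]] := eqVneq E set0.
    rewrite E0 (_ : evalp _ = cst 0); first exact: multiplier_cst.
    by apply/funext => theta; rewrite /evalp measure0.
  have -> : E = [set a].
    apply/seteqP; split => [x Ex|_ ->//].
    move: Ex Ea => [[Ax _] /= fx] [[Aa _] /= fa].
    by apply: finj; rewrite ?inE// fx fa.
  by case: Ea => -[Aa _] _; exact: multiplier_evalp1.
have mL := measurable_supported_in mA.
apply: (@multiplier_cvg _ _ _ _ _ _ mL Theta1A Theta2A _ mon1 same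
  (fun n => evalp (F n)) _ 1) => //.
- move=> n theta; have /andP[? ?] := evalp_ge0_le1 theta (mF n).
  by rewrite ger0_norm.
- exact: measurable_evalp.
- exists 1 => theta; have /andP[? ?] := evalp_ge0_le1 theta mU.
  by rewrite ger0_norm.
- move=> theta thA; apply: fine_cvg; rewrite EFin_evalp//.
  have -> : (theta : probability R R) U = (theta : probability R R) (\bigcup_n F n).
    rewrite -(supported_inI mA mU thA); congr (_ _).
    apply/seteqP; split => [x AUx|x [n _ []]//].
    by exists (f x).+1 => //; split => //=.
  apply: nondecreasing_cvg_mu => //; first exact: bigcup_measurable.
  move=> m n mn; apply/subsetPset => x [AUx /= fx]; split => //=.
  exact: leq_trans mn.
Qed.

(** The events whose indicator is a multiplier form a pi-system, as products of multipliers are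
    multipliers. Both measures agree on it, and it contains the generators [theta(U) < r], so
    uniqueness of measures applies. *)
Lemma eq_of_same_moments : measure_eq Theta1 Theta2.
Proof.
pose G := [set B : set (pprobability R R) | measurable B /\ multiplier \1_B].
have GI : setI_closed G.
  move=> B C [mB GB] [mC GC]; split; first exact: measurableI.
  by rewrite indicI; exact: multiplierM.
have pG : @pset _ R R `<=` G.
  move=> _ [r r01 [U mU <-]].
  have mult : multiplier \1_(mset U r).
    rewrite (_ : \1_ _ = fun theta => (evalp U theta < r)%R%:R).
      have mL := measurable_supported_in mA.
      apply: (multiplier_lt mL Theta1A Theta2A mon1 same) => //.
      - exact: multiplier_evalp.
      - by move=> theta; exact: evalp_ge0_le1.
    apply/funext => theta; rewrite indicE; congr (_ %:R); congr nat_of_bool.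
    by rewrite -lte_fin EFin_evalp//; apply/idP/idP; rewrite in_setE.
  split => //; apply: sub_sigma_algebra.
  by exists r => //; exists U.
have GT : G setT.
  split => //; rewrite indicT; exact: multiplier_cst.
have mG : (measurable : set (set (pprobability R R))) = <<s G >>.
  apply/seteqP; split; first exact: sub_smallest2r.
  apply: smallest_sub; first exact: sigma_algebra_measurable.
  by move=> B [].
move=> B mB; apply: (measure_unique G (fun=> setT)) => //.
- by rewrite bigcup_const//; exists 0%N.
- move=> C [mC /(multiplier_mean mon1 same)[_ _]].
  by rewrite !integral_indic// !setIT.
- by move=> _; rewrite /= -ge0_fin_numE// fin_num_measure.
Qed.

End determined_by_moments.

(** * Linear independence and multisets *)

(** The larger sequence [t] allows two sums to be expanded over one common list of distinct
    terms. *)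
Lemma big_undup_count (R : pzRingType) (s t : seq R) : {subset s <= t} ->
  \sum_(a <- s) a = \sum_(a <- undup t) a *+ count_mem a s.
Proof.
elim: s => [|x s IHs] st.
  by rewrite big_nil big1.
rewrite big_cons IHs; last by move=> a sa; apply: st; rewrite inE sa orbT.
have xt : x \in undup t by rewrite mem_undup st// inE eqxx.
rewrite (bigD1_seq x)/= ?undup_uniq// [RHS](bigD1_seq x)/= ?undup_uniq//.
rewrite eqxx add1n mulrS -addrA; congr (_ + (_ + _)).
by apply: eq_bigr => a ax; rewrite eq_sym (negbTE ax) add0n.
Qed.

(** The differences of multiplicities are the coefficients of a vanishing rational combination of
    distinct elements of [A], so they are all 0. *)
Lemma perm_eq_of_eq_sum (R : realType) (A : set R) (s t : seq R) :
  linearly_independent_over_Q A ->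
  (forall a, a \in s -> A a) -> (forall a, a \in t -> A a) ->
  \sum_(a <- s) a = \sum_(a <- t) a -> perm_eq s t.
Proof.
move=> indep sA tA st; pose u := undup (s ++ t).
pose q (a : R) : rat := (count_mem a s)%:R - (count_mem a t)%:R.
have uA a : a \in u -> A a by rewrite mem_undup mem_cat => /orP[/sA|/tA].
have q0 : \sum_(a <- u) ratr (q a) * a = 0.
  under eq_bigr do rewrite /q rmorphB/= !ratr_nat mulrBl !mulr_natl.
  rewrite sumrB -!big_undup_count ?st ?subrr// => a;
    by rewrite mem_cat => ->; rewrite ?orbT.
have {}q0 a : a \in u -> q a = 0 by apply: indep q0 a => //; exact: undup_uniq.
apply/allP => a; rewrite mem_cat => ast.
have /q0/eqP : a \in u by rewrite mem_undup mem_cat.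
by rewrite subr_eq0 eqr_nat.
Qed.

(** * Mixed moments from the laws of the partial sums *)

Section moments.
Context {R : realType}.
Variables (Theta : probability (pprobability R R) R).
Context {d : measure_display} {W : measurableType d} {P : probability W R}.
Variable X : nat -> {RV P >-> R}.
Hypothesis XTheta : iid_mixture Theta X.

Lemma measurable_cylinder n (B : nat -> set R) : (forall j, measurable (B j)) ->
  measurable [set w | forall j, (j < n)%N -> B j (X j w)].
Proof.
move=> mB.
rewrite (_ : [set _ | _] = \bigcap_(j in [set j | (j < n)%N]) (X j @^-1` B j)).
  by apply: bigcap_measurableType => j _; exact: measurable_funPTI.
by apply/seteqP; split => w Bw j; exact: Bw.
Qed.

Lemma iid_mixture_cylinder n (B : nat -> set R) :
  (forall j, measurable (B j)) ->
  P [set w | forall j, (j < n)%N -> B j (X j w)] =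
  (\int[ Theta ]_theta (\prod_(j < n) evalp (B j) theta)%:E)%E.
Proof.
move=> mB; have [prodm [prodmE PE]] := XTheta.
pose C := [set x : nat -> R | forall j, (j < n)%N -> B j (x j)].
have mC : measurable (C : set (real_sequences R)).
  rewrite (_ : C = \bigcap_(j in [set j | (j < n)%N])
    ((fun x : real_sequences R => x j) @^-1` B j)); last first.
    by apply/seteqP; split => w Bw j; exact: Bw.
  apply: bigcap_measurableType => j _; apply: sub_sigma_algebra.
  by exists j => //; exists (B j) => //; rewrite setTI.
rewrite (PE _ mC); apply: eq_integral => theta _.
rewrite prodmE// -prodEFin; apply: eq_bigr => j _.
by rewrite EFin_evalp.
Qed.

Variable A : set R.
Hypotheses (mA : measurable A) (indep : linearly_independent_over_Q A).
Hypothesis ThetaA : Theta (supported_in A) = 1%E.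

Lemma iid_mixture_in_support n :
  P [set w | forall j, (j < n)%N -> A (X j w)] = 1%E.
Proof.
rewrite (iid_mixture_cylinder _ (fun=> mA)).
rewrite -[RHS](probability_setT Theta) -[RHS]mul1e -integral_cst//.
apply: ae_eq_integral => //.
  by apply/measurable_EFinP; apply: measurable_prod => j _; exact: measurable_evalp.
apply: (full_ae (measurable_supported_in mA) ThetaA) => theta thA _.
by rewrite big1// => j _; rewrite /evalp thA.
Qed.

(** Almost surely the first n terms lie in [A], and then their sum fixes them up to order. The event
    splits into one box for each distinct rearrangement of [s], all of the same probability because
    the product of atoms is symmetric. *)
Lemma sum_distribution_moment (s : seq R) : (forall a, a \in s -> A a) ->
  P [set w | partial_sum X (size s) w = \sum_(a <- s) a] =
  ((size (permutations s))%:R%:E *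
   \int[ Theta ]_theta (\prod_(a <- s) evalp [set a] theta)%:E)%E.
Proof.
move=> sA; set n := size s; set S := [set w | _].
pose E := [set w | forall j, (j < n)%N -> A (X j w)].
pose F (t : seq R) := [set w | forall j, (j < n)%N -> [set nth 0 t j] (X j w)].
have mE : measurable E := @measurable_cylinder n _ (fun=> mA).
have mF t : measurable (F t) :=
  @measurable_cylinder n _ (fun j => measurable_set1 (nth 0 t j)).
have mS : measurable S.
  exact: (measurable_funPTI (partial_sum X n) (measurable_set1 _)).
have PF t : perm_eq t s ->
    P (F t) = (\int[ Theta ]_theta (\prod_(a <- s) evalp [set a] theta)%:E)%E.
  move=> ts; rewrite (@iid_mixture_cylinder n (fun j => [set nth 0 t j]))//.
  apply: eq_integral => theta _; rewrite -(perm_big _ ts)/= [in RHS](big_nth 0) big_mkord.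
  by rewrite (perm_size ts).
(* The complement of [E] is a null event. *)
have -> : P S = P (S `&` E).
  rewrite (measureDI P mS mE) [X in (X + _)%E](_ : _ = 0%E) ?add0e//.
  apply/eqP; rewrite eq_le measure_ge0 andbT.
  have <- : P (~` E) = 0%E.
    by rewrite probability_setC// iid_mixture_in_support subee.
  apply: le_measure; rewrite ?inE; [exact: measurableD|exact: measurableC|].
  by move=> x [].
(* A point of the left side lies in the box of its own values, which [perm_eq_of_eq_sum] shows to be
   a rearrangement of [s]. *)
have -> : S `&` E = \bigcup_(t in [set` permutations s]) F t.
  apply/seteqP; split => w.
    rewrite /S /= mfun_sum => -[Sw Ew].
    have zE : size [seq X j w | j <- iota 0 n] = n by rewrite size_map size_iota.
    exists [seq X j w | j <- iota 0 n] => /=.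
      rewrite mem_permutations; apply: perm_eq_of_eq_sum indep _ sA _.
        by move=> a /mapP[j]; rewrite mem_iota => /andP[_ jn] ->; exact: Ew.
      by rewrite big_map -Sw -(big_mkord xpredT (fun j => X j w)) /index_iota subn0.
    by move=> j jn /=; rewrite (nth_map 0%N) ?size_iota// nth_iota.
  move=> [t /=]; rewrite mem_permutations => ts Fw.
  have tn : size t = n by rewrite (perm_size ts).
  split; last first.
    by move=> j jn; rewrite (Fw _ jn); apply: sA; rewrite -(perm_mem ts) mem_nth ?tn.
  rewrite /S /= mfun_sum -(perm_big _ ts)/= (big_nth 0) big_mkord tn.
  by apply: eq_bigr => j _; exact: Fw.
have fin : finite_set [set` permutations s] by exact: finite_seq.
(* The boxes are disjoint: a common point would give two rearrangements with the same entries. *)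
rewrite measure_fin_bigcup//; last first.
  move=> t u /=; rewrite !mem_permutations => ts us [w [tw uw]].
  apply: (@eq_from_nth _ 0); first by rewrite (perm_size ts) (perm_size us).
  by move=> j; rewrite (perm_size ts) => jn; rewrite -(tw _ jn) -(uw _ jn).
rewrite -fsbig_seq ?permutations_uniq//.
rewrite (eq_big_seq (fun=>
  \int[ Theta ]_theta (\prod_(a <- s) evalp [set a] theta)%:E)%E).
  by rewrite big_const_seq count_predT -Monoid.iteropE mule_natl.
by move=> t; rewrite mem_permutations; exact: PF.
Qed.

End moments.

(** * Equal laws of partial sums force equal mixing measures *)

Theorem theorem2p2p1 (R : realType) (A : set R)
  (A_countable : countable A)
  (A_discrete : limit_point A = set0)
  (A_indep : linearly_independent_over_Q A) :
  good (supported_in A).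
Proof.
have mA : measurable A.
  by apply: countable_measurable => // t; exact: measurable_set1.
split; first exact: measurable_supported_in.
move=> Theta1 Theta2 d1 W1 P1 X d2 W2 P2 Y T1A T2A XT YT XY.
apply: (@eq_of_same_moments _ A) => // _ [s sA ->]; split.
- by apply: measurable_prod => a _; exact: measurable_evalp.
- exists 1 => theta; rewrite ger0_norm.
    by apply: prodr_ile1 => a _; exact: evalp_ge0_le1.
  by apply: prodr_ge0 => a _; have /andP[] := evalp_ge0_le1 theta (measurable_set1 a).
(* The laws are compared only for n >= 1, so the empty monomial is treated apart: its mean is the
   total mass 1. *)
have [->|s0] := eqVneq s [::].
  under eq_integral do rewrite big_nil.
  under [RHS]eq_integral do rewrite big_nil.
  rewrite !integral_cst//; congr (_ * _)%E.
  exact: etrans (probability_setT Theta1) (esym (probability_setT Theta2)).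
have sz : (0 < size s)%N by rewrite lt0n size_eq0.
have : P1 [set w | partial_sum X (size s) w = \sum_(a <- s) a] =
       P2 [set w | partial_sum Y (size s) w = \sum_(a <- s) a].
  exact: XY _ sz [set \sum_(a <- s) a] (measurable_set1 _).
rewrite (sum_distribution_moment XT mA A_indep T1A sA).
rewrite (sum_distribution_moment YT mA A_indep T2A sA).
set k := size (permutations s) => /(congr1 (mule (k%:R^-1)%:E)).
(* The list of rearrangements contains [s] itself, so the common factor can be cancelled. *)
have k0 : k%:R != 0 :> R.
  rewrite pnatr_eq0 size_eq0; apply/negP => /eqP ps0.
  by have := mem_permutations s s; rewrite ps0 perm_refl.
by rewrite !muleA -!EFinM mulVf// !mul1e.
Qed.
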